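(* Let $E: y^2=x^3+ax^2+bx+c$ ($a,b,c\in\mathbb{Z}$) be an elliptic curve, $P\in E(\mathbb{Q})$ a point of infinite order, $k\ge1$, and $p$ an odd prime. If both $2^{k-1}P$ and $2^kP$ reduce to singular points modulo $p$, then $p\mid\tau_k$.
   Context: An elliptic curve is a non-singular cubic $y^2=x^3+ax^2+bx+c$ with $a,b,c\in\mathbb{Z}$, projectively $y^2z=x^3+ax^2z+bxz^2+cz^3$. For $k\ge0$ write $2^kP=\left(\frac{m_k}{e_k^2},\frac{n_k}{e_k^3}\right)$ with $m_k,n_k,e_k\in\mathbb{Z}$, $e_k\ge1$, $\gcd(m_k,e_k)=\gcd(n_k,e_k)=1$. Define $F_0(E,P)=e_0$, $F_k(E,P)=e_k/e_{k-1}$ and $\tau_k=\frac{2n_{k-1}}{F_k(E,P)}\in\mathbb{Z}$ for $k\ge1$. A point $\left(\frac{m}{e^2},\frac{n}{e^3}\right)$ reduces mod $p$ to $(me\bmod p:n\bmod p:e^3\bmod p)$ on the curve $y^2z=x^3+ax^2z+bxz^2+cz^3$ over $\mathbb{F}_p$; a singular point is one where this cubic form and all its partial derivatives vanish. *)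

(* Defs.v *)
From HB Require Import structures.
From mathcomp Require Export all_boot all_order all_algebra all_field.
From mathcomp.multinomials Require Export mpoly.

Set Implicit Arguments.
Unset Strict Implicit.
Unset Printing Implicit Defensive.

Import Order.TTheory GRing.Theory Num.Theory.
Local Open Scope ring_scope.

(* y^2 z - (x^3 + a x^2 z + b x z^2 + c z^3), with (x, y, z) = ('X_0, 'X_1, 'X_2) *)
Definition weierstrass_form (F : fieldType) (a b c : F) : {mpoly F[3]} :=
  let x : {mpoly F[3]} := 'X_(inord 0) in
  let y : {mpoly F[3]} := 'X_(inord 1) in
  let z : {mpoly F[3]} := 'X_(inord 2) in
  y ^+ 2 * z
    - (x ^+ 3 + a *: (x ^+ 2 * z) + b *: (x * z ^+ 2) + c *: z ^+ 3).

(* v is a triple of homogeneous coordinates; nonzero, so that it defines a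
   point of the projective plane. *)
Definition singular_point (F : fieldType) (a b c : F) (v : 3.-tuple F) : Prop :=
  [/\ v <> [tuple 0; 0; 0],
      meval (tnth v) (weierstrass_form a b c) = 0
    & forall i : 'I_3, meval (tnth v) (mderiv i (weierstrass_form a b c)) = 0].

(* Nonsingularity is geometric: no singular point over the algebraic closure
   of the rationals. *)
Definition elliptic_curve (a b c : int) : Prop :=
  forall v : 3.-tuple algC, ~ singular_point a%:~R b%:~R c%:~R v.

Inductive point (F : Type) : Type :=
| Infinity
| Affine of F & F.
Arguments Infinity {F}.

Definition on_curve (F : fieldType) (a b c : F) (P : point F) : Prop :=
  if P is Affine x y then y ^+ 2 = x ^+ 3 + a * x ^+ 2 + b * x + c else True.

(* The chord-and-tangent group law, meaningful for points on the curve; it does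
   not involve the coefficient c. When the abscissas agree and y1 <> - y2, the
   curve equation forces y1 = y2 <> 0. *)
Definition addpt (F : fieldType) (a b : F) (P Q : point F) : point F :=
  match P, Q with
  | Infinity, _ => Q
  | _, Infinity => P
  | Affine x1 y1, Affine x2 y2 =>
    if (x1 == x2) && (y1 == - y2) then Infinity else
    let l := if x1 == x2 then (3 * x1 ^+ 2 + 2 * a * x1 + b) / (2 * y1)
             else (y2 - y1) / (x2 - x1) in
    let x3 := l ^+ 2 - a - x1 - x2 in
    Affine x3 (l * (x1 - x3) - y1)
  end.

Definition mulpt (F : fieldType) (a b : F) (n : nat) (P : point F) : point F :=
  iter n (addpt a b P) Infinity.

Definition infinite_order (F : fieldType) (a b : F) (P : point F) : Prop :=
  forall n : nat, (0 < n)%N -> mulpt a b n P <> Infinity.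

(* 2^k P, by k successive doublings *)
Definition mul2expt (F : fieldType) (a b : F) (k : nat) (P : point F) : point F :=
  iter k (fun Q => addpt a b Q Q) P.

Definition lowest_terms (P : point rat) (m n e : int) : Prop :=
  [/\ P = Affine (m%:~R / e%:~R ^+ 2) (n%:~R / e%:~R ^+ 3),
      1 <= e, coprimez m e & coprimez n e].

Definition reduction (p : nat) (m n e : int) : 3.-tuple 'F_p :=
  [tuple (m * e)%:~R; n%:~R; (e ^+ 3)%:~R].

Definition reduces_to_singular (a b c : int) (p : nat) (m n e : int) : Prop :=
  singular_point (a%:~R : 'F_p) b%:~R c%:~R (reduction p m n e).

(* In the sequences below, n k and e k are the n_k and e_k of 2^k P. *)
Definition Fseq (e : nat -> int) (k : nat) : rat :=
  if k is j.+1 then (e k)%:~R / (e j)%:~R else (e 0%N)%:~R.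

Definition tau (n e : nat -> int) (k : nat) : rat :=
  2 * (n k.-1)%:~R / Fseq e k.

(* Main.v *)
(** Doubling [(m/e^2, n/e^3)] gives an abscissa with denominator dividing
    [(2ne)^2], so the denominator [e'] of the double divides [2ne], and
    [tau = 2ne/e']. For odd [p], a point with singular reduction has [p | n] and
    [p] prime to [e]: the first applied to the point gives [p | 2ne = tau e'],
    the second applied to its double gives that [p] is prime to [e']. *)

Require Import Defs.
From mathcomp Require Import ring.
Set Implicit Arguments.
Unset Strict Implicit.

Import Order.TTheory GRing.Theory Num.Theory.
Local Open Scope ring_scope.

Lemma mderivXU (n : nat) (R : comNzRingType) (i j : 'I_n) :
  mderiv i ('X_j : {mpoly R[n]}) = (j == i)%:R.
Proof.
rewrite mderivX mnm1E; case: eqP => [-> | _]; last by rewrite scale0r.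
by rewrite -[X in (X - _)%MM]add0m addmK mpolyX0 scale1r.
Qed.

Lemma meval_mderiv_weierstrass_y (F : fieldType) (a b c : F) (v : 'I_3 -> F) :
  meval v (mderiv (inord 1) (weierstrass_form a b c))
  = 2 * v (inord 1) * v (inord 2).
Proof.
(* Powers become products, so the Leibniz rule and the derivatives of the variables suffice. *)
rewrite /weierstrass_form !exprS !expr0 !mulr1.
rewrite !(mderivB, mderivD, mderivZ, mderivM, mderivXU).
rewrite -!val_eqE /= !inordK //=.
rewrite !(mevalB, mevalD, mevalZ, mevalM, mevalXU, meval0, meval1).
ring.
Qed.

Lemma meval_mderiv_weierstrass_z (F : fieldType) (a b c : F) (v : 'I_3 -> F) :
  meval v (mderiv (inord 2) (weierstrass_form a b c))
  = v (inord 1) ^+ 2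
    - (a * v (inord 0) ^+ 2 + 2 * b * v (inord 0) * v (inord 2)
       + 3 * c * v (inord 2) ^+ 2).
Proof.
rewrite /weierstrass_form !exprS !expr0 !mulr1.
rewrite !(mderivB, mderivD, mderivZ, mderivM, mderivXU).
rewrite -!val_eqE /= !inordK //=.
rewrite !(mevalB, mevalD, mevalZ, mevalM, mevalXU, meval0, meval1).
ring.
Qed.

(** The partial derivative in [z] rules out [e = 0] in ['F_p]; the one in [y], equal to [2yz], then
    forces [n = 0]. *)
Lemma reduces_to_singular_dvd (a b c : int) (p : nat) (m n e : int) :
    prime p -> odd p -> reduces_to_singular a b c p m n e ->
  (p %| n)%Z /\ ~~ (p %| e)%Z.
Proof.
move=> p_pr p_odd [v_neq0 _ dv].
have charFp := pchar_Fp p_pr.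
have two_neq0 : 2%:R != 0 :> 'F_p.
  rewrite -(dvdn_pcharf charFp); apply: contraL p_odd => /dvdn_leq p_le2.
  by case: p p_pr p_le2 {v_neq0 dv charFp} => [|[|[|p]]] // _ /(_ isT).
have := dv (inord 1); have := dv (inord 2).
rewrite meval_mderiv_weierstrass_y meval_mderiv_weierstrass_z.
rewrite !(tnth_nth 0) !inordK //= !rmorphXn !rmorphM /=.
rewrite !(dvdz_pcharf charFp).
have [e0 | e_neq0] := eqVneq (e%:~R : 'F_p) 0.
  (* Here the triple is [(0, n, 0)], where the [z]-derivative is [n ^+ 2]; its vanishing makes the
     whole triple zero. *)
  rewrite e0 => dz _; case: v_neq0.
  have /eqP n0 : (n%:~R : 'F_p) == 0.
    by rewrite -sqrf_eq0 -[X in X == _]subr0 -[X in _ == X]dz; apply/eqP; ring.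
  by apply: val_inj; rewrite /= !rmorphXn !rmorphM /= e0 n0 mulr0 expr0n.
move=> _ /eqP; rewrite !mulf_eq0 (negbTE two_neq0) (negbTE e_neq0).
by rewrite !orbF.
Qed.

Lemma lowest_terms_double_dvd (a b : int) (Q : point rat) (m n e m' n' e' : int) :
    lowest_terms Q m n e -> lowest_terms (addpt a%:~R b%:~R Q Q) m' n' e' ->
  (e' %| 2 * n * e)%Z.
Proof.
move=> [-> e_ge1 _ _] [+ e'_ge1 co_m' _].
(* If [y = - y], the double is [Infinity], which has no lowest terms. *)
rewrite /addpt eqxx andTb; case: eqP => // y_neq [x_eq _].
have e_neq0 : e%:~R != 0 :> rat by rewrite intr_eq0 gt_eqF // -gtz0_ge1.
have e'_neq0 : e'%:~R != 0 :> rat by rewrite intr_eq0 gt_eqF // -gtz0_ge1.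
have n_neq0 : n%:~R != 0 :> rat.
  by apply/eqP => n0; apply: y_neq; rewrite n0 mul0r oppr0.
(* Since [e' ^+ 2] is prime to [m'], it is enough that it divides [m' * (2 * n * e) ^+ 2]. *)
rewrite -(@dvdz_pexp2r _ _ 2) // -(@Gauss_dvdzr _ m'); last first.
  by rewrite coprimez_sym coprimezXr.
apply/dvdzP.
(* The numerator of [l ^+ 2 - a - 2x] over [(2ne) ^+ 2], for the tangent slope [l] at
   [x = m / e ^+ 2]. *)
exists ((3 * m ^+ 2 + 2 * a * m * e ^+ 2 + b * e ^+ 4) ^+ 2
        - 4 * n ^+ 2 * (a * e ^+ 2 + 2 * m)).
apply: (@intr_inj rat).
have -> : (m' * (2 * n * e) ^+ 2)%:~R
    = m'%:~R / e'%:~R ^+ 2 * e'%:~R ^+ 2 * (2 * n%:~R * e%:~R) ^+ 2 :> rat.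
  by field.
rewrite -x_eq; field.
by rewrite n_neq0 e_neq0.
Qed.

Theorem theorem5p6 (a b c : int) (P : point rat) (m n e : nat -> int) (k p : nat)
  (hE : elliptic_curve a b c)
  (hP : on_curve a%:~R b%:~R c%:~R P)
  (hord : infinite_order a%:~R b%:~R P)
  (hmne : forall j : nat,
      lowest_terms (mul2expt a%:~R b%:~R j P) (m j) (n j) (e j))
  (hk : (1 <= k)%N)
  (hp : prime p)
  (hodd : odd p)
  (hsing1 : reduces_to_singular a b c p (m k.-1) (n k.-1) (e k.-1))
  (hsing2 : reduces_to_singular a b c p (m k) (n k) (e k)) :
  exists t : int, tau n e k = t%:~R /\ (p %| t)%Z.
Proof.
case: k hk hsing1 hsing2 => // k _ /= hsing1 hsing2.
have [p_n _] := reduces_to_singular_dvd hp hodd hsing1.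
have [_ p_e'] := reduces_to_singular_dvd hp hodd hsing2.
(* The index is shifted: [k] now stands for the original [k.-1], and the quotient [t] is [tau]. *)
have /dvdzP[t t_eq] := lowest_terms_double_dvd (hmne k) (hmne k.+1).
exists t; split.
  have e'_neq0 : (e k.+1)%:~R != 0 :> rat.
    by have [_ e_ge1 _ _] := hmne k.+1; rewrite intr_eq0 gt_eqF // -gtz0_ge1.
  have /(congr1 (fun z : int => z%:~R : rat)) := t_eq.
  rewrite !rmorphM /= /tau /Fseq /= => tE.
  by rewrite invf_div mulrA tE mulfK.
have : (p %| t * e k.+1)%Z by rewrite -t_eq -mulrA dvdz_mull // dvdz_mulr.
by rewrite !(dvdz_pcharf (pchar_Fp hp)) rmorphM /= mulf_eq0
  -!(dvdz_pcharf (pchar_Fp hp)) (negbTE p_e') orbF.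
Qed.
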